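(* Let $a,b$ be positive integers and let $\{F_n(q)\}_{n\geq 0}$ be the $q$-biperiodic Fibonacci sequence. For every integer $n\geq 0$, $$\sum_{k=1}^{n+1}q^kF_k(q)\,a^{\xi(n)\xi(k)}\,b^{\xi(k+1)-\xi(n)\xi(k+1)}\,(ab)^{\left\lfloor\frac{n-k+1}{2}\right\rfloor}=F_{n+3}(q)-a^{\xi(n)}(ab)^{\left\lfloor\frac{n+2}{2}\right\rfloor}.$$
   Context: Fix positive integers $a,b$; $q$ is an indeterminate. The $q$-biperiodic Fibonacci sequence is defined by $F_0(q)=0$, $F_1(q)=1$ and, for $n\geq 2$, $F_n(q)=aF_{n-1}(q)+q^{n-2}F_{n-2}(q)$ if $n$ is even, $F_n(q)=bF_{n-1}(q)+q^{n-2}F_{n-2}(q)$ if $n$ is odd. For an integer $n$, $\xi(n)=n-2\lfloor n/2\rfloor$ (so $\xi(n)=0$ if $n$ is even and $1$ if $n$ is odd). *)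

(* Defs.v *)
From HB Require Import structures.
From mathcomp Require Import all_boot all_order all_algebra.

Set Implicit Arguments.
Unset Strict Implicit.
Unset Printing Implicit Defensive.

Import GRing.Theory.
Local Open Scope ring_scope.

Definition xi (n : nat) : nat := (n - 2 * (n %/ 2))%N.

(* The indeterminate q is 'X in {poly int}. *)
Fixpoint qbifib (a b n : nat) : {poly int} :=
  match n with
  | 0%N => 0
  | 1%N => 1
  | (m.+1 as p).+1 =>
      (if odd m.+2 then b else a)%:R * qbifib a b p + 'X^m * qbifib a b m
  end.

(* Main.v *)
(* Write [w n k] for the coefficient of [q^k F_k]. Passing from [n] to [n.+1]
   multiplies every [w n k] by the factor ([a] or [b]) of the recurrence that
   produces [F_(n+4)], while [w n n.+1 = 1]; hence both sides of the identity
   satisfy the same first-order recurrence in [n]. *)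
Require Import Defs.
From HB Require Import structures.
From mathcomp Require Import all_boot all_order all_algebra.
From mathcomp Require Import ring.

Set Implicit Arguments.
Unset Strict Implicit.
Unset Printing Implicit Defensive.

Import GRing.Theory.
Local Open Scope ring_scope.

Lemma xiE (n : nat) : xi n = odd n.
Proof. by rewrite /xi {1}(divn_eq n 2) mulnC addKn modn2. Qed.

Lemma qbifibSS (a b m : nat) :
  qbifib a b m.+2
  = (if odd m then b else a)%:R * qbifib a b m.+1 + 'X^m * qbifib a b m.
Proof. by rewrite /= negbK. Qed.

Definition weight (R : comPzRingType) (x y : R) (n k : nat) : R :=
  x ^+ (xi n * xi k) * y ^+ (xi k.+1 - xi n * xi k.+1)
  * (x * y) ^+ ((n + 1 - k) %/ 2).

Lemma weight_last (R : comPzRingType) (x y : R) (n : nat) :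
  weight x y n n.+1 = 1.
Proof.
rewrite /weight !xiE addn1 subnn div0n expr0 mulr1 /=.
by case: (odd n); rewrite /= !expr0 mulr1.
Qed.

(** Outside the power of [x * y], the weight is [x] if [n] and [k] are both odd, [y] if both are
    even, and 1 otherwise. So a step in [n] either creates this lone factor, or removes it while the
    floor rises and brings in [x * y], leaving the other letter. *)
Lemma weightS (R : comPzRingType) (x y : R) (n k : nat) : (k <= n.+1)%N ->
  weight x y n.+1 k = (if odd n then y else x) * weight x y n k.
Proof.
(* With [d] the exact difference, the two floors become [uphalf d] and [d./2], and only the parities
   of [k] and [d] matter. *)
move=> le_kn; have [d def_n] : exists d, n.+1 = (k + d)%N.
  by exists (n.+1 - k)%N; rewrite subnKC.
have odd_n : odd n = ~~ (odd k (+) odd d).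
  by rewrite -oddD -def_n /= negbK.
rewrite /weight !xiE !addn1 def_n -addnS !addKn !divn2 /= uphalf_half.
rewrite odd_n oddD.
by case: (odd k); case: (odd d);
  rewrite /= ?add0n ?add1n ?exprS ?expr0; ring.
Qed.

Lemma qbifib_weighted_sum (a b n : nat) :
  \sum_(1 <= k < n.+2) 'X^k * qbifib a b k * weight a%:R b%:R n k
  = qbifib a b n.+3 - a%:R ^+ odd n * (a%:R * b%:R) ^+ n./2.+1.
Proof.
elim: n => [|n IHn].
  by rewrite big_nat1 weight_last !qbifibSS /= expr0 !expr1; ring.
(* The new last term is exactly the ['X^n.+2] term in the recurrence for [qbifib a b n.+4]. *)
rewrite big_nat_recr // weight_last mulr1.
have -> : \sum_(1 <= k < n.+2) 'X^k * qbifib a b k * weight a%:R b%:R n.+1 k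
    = (if odd n then b%:R else a%:R)
      * \sum_(1 <= k < n.+2) 'X^k * qbifib a b k * weight a%:R b%:R n k.
  rewrite big_distrr; apply: eq_big_nat => k /andP[_ le_kn].
  by rewrite weightS // mulrCA.
(* The subtracted monomial scales by the same factor: [a] appears when [n] is even, and [b]
   completes a further [a * b] when [n] is odd. *)
have half_nS : n.+1./2 = (odd n + n./2)%N by rewrite -uphalf_half.
rewrite IHn (qbifibSS a b n.+2) half_nS !oddS negbK.
move: (qbifib a b n.+2) (qbifib a b n.+3) => F2 F3.
by case: (odd n); rewrite /= ?add0n ?add1n ?exprS ?expr0; ring.
Qed.

Theorem theorem13 (a b : nat) (ha : (0 < a)%N) (hb : (0 < b)%N) (n : nat) :
  \sum_(1 <= k < n.+2)
     'X^k * qbifib a b k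
     * a%:R ^+ (xi n * xi k)
     * b%:R ^+ (xi k.+1 - xi n * xi k.+1)
     * (a * b)%:R ^+ ((n + 1 - k) %/ 2)
  = qbifib a b (n + 3)
    - a%:R ^+ xi n * (a * b)%:R ^+ ((n + 2) %/ 2) :> {poly int}.
Proof.
rewrite addn3 addn2 divn2 xiE natrM /= -qbifib_weighted_sum.
by apply: eq_bigr => k _; rewrite /weight !xiE !mulrA.
Qed.
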